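(* Let $y\in[0,1]$, assume $\mu_y$ has no atoms, and let $\varphi_y$ be the distribution function of $\mu_y$. For $\epsilon_0\in(0,1/N)$, $l\ge1$ and $i_1,\dots,i_l\in\Sigma_N$, let $\mathrm{Sep}(\epsilon_0;i_1,\dots,i_l)$ denote the condition $$Y(y)\cap\bigcap_{i\in\Sigma_N}G_i^{-1}\left(\left[\tfrac1N-\epsilon_0,\tfrac1N+\epsilon_0\right]\right)\cap\bigcap_{j\in\Sigma_N}\left(G_j\circ H_{i_l}\circ\cdots\circ H_{i_1}\right)^{-1}\left(\left[\tfrac1N-\epsilon_0,\tfrac1N+\epsilon_0\right]\right)=\emptyset .$$ (i) If $$0<\inf_{i\in\Sigma_N,\,w\in Y(y)}G_i(w)\le\sup_{i\in\Sigma_N,\,w\in Y(y)}G_i(w)<1$$ and $\mathrm{Sep}(\epsilon_0;i_1,\dots,i_l)$ holds for some $\epsilon_0\in(0,1/N)$, $l\ge1$ and $i_1,\dots,i_l\in\Sigma_N$, then $\dim_H\mu_y<1$. (ii) If $\mathrm{Sep}(\epsilon_0;i_1,\dots,i_l)$ holds for some $\epsilon_0\in(0,1/N)$, $l\ge1$ and $i_1,\dots,i_l\in\Sigma_N$, then for every $(p_0,\dots,p_{N-1})$-self-similar measure $\mu_{(p_0,\dots,p_{N-1})}$ with all $p_i>0$, at $\mu_{(p_0,\dots,p_{N-1})}$-almost every point, $\varphi_y$ does not have a non-zero derivative. (iii) If there are $\epsilon_0\in(0,1/N)$ and $l\ge1$ such that $\mathrm{Sep}(\epsilon_0;i_1,\dots,i_l)$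 holds for every $i_1,\dots,i_l\in\Sigma_N$, then there is no point at which $\varphi_y$ has a non-zero derivative, and $\dim_H\mu_y<1$.
   Context: Let $N\ge2$, $\Sigma_N=\{0,\dots,N-1\}$, $Y=[0,1]$, and $S_i(z)=(z+i)/N$ for $z\in[0,1]$, $i\in\Sigma_N$. Let $H_i:Y\to Y$ and $G_i:Y\to[0,1]$, $i\in\Sigma_N$, be maps with $\sum_{i}G_i(y)=1$ for all $y\in Y$. Let $\{\mu_y\}_{y\in Y}$ be the unique family of Borel probability measures on $[0,1]$ with $\mu_y=\sum_{i\in\Sigma_N}G_i(y)\,\mu_{H_i(y)}\circ S_i^{-1}$ for all $y\in Y$. For $y\in Y$ let $Y(y)=\{H_{i_l}\circ\cdots\circ H_{i_1}(y):i_1,\dots,i_l\in\Sigma_N,\ l\ge1\}$. For $p_i$ with $\sum_i p_i=1$, the $(p_0,\dots,p_{N-1})$-self-similar measure $\mu_{(p_0,\dots,p_{N-1})}$ is the unique Borel probability measure $\mu$ on $[0,1]$ with $\mu=\sum_i p_i\,\mu\circ S_i^{-1}$. ''Derivative'' means finite derivative. For a Borel probability measure $\mu$, $\dim_H\mu=\inf\{\dim_H B: B\text{ Borel},\ \mu(B)=1\}$, with $\dim_H$ the Hausdorff dimension. *)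

(* Defs.v *)
From HB Require Import structures.
From mathcomp Require Export all_boot all_order all_algebra.
From mathcomp Require Export all_classical all_reals all_analysis.

Set Implicit Arguments.
Unset Strict Implicit.
Unset Printing Implicit Defensive.

Export Order.TTheory GRing.Theory Num.Theory.
Export numFieldNormedType.Exports.

#[global] Open Scope classical_set_scope.
#[global] Open Scope ring_scope.

Section hausdorff_dimension.
Context {R : realType}.
Local Open Scope ereal_scope.

(* [ereal_sup set0] is [-oo]; adding [0] gives the empty set diameter [0]. *)
Definition diameter (A : set R) : \bar R :=
  ereal_sup (0 |` [set `|x.1 - x.2|%:E | x in A `*` A]).

(* [diam(A)^s]; the empty set contributes [0] even when [s = 0], while a
   nonempty set then contributes [1], so that the 0-dimensional Hausdorff
   measure is the counting measure. *)
Definition diameter_pow (s : R) (A : set R) : \bar R :=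
  if `[< A = set0 >] then 0 else diameter A `^ s.

Definition hausdorff_premeasure (s delta : R) (A : set R) : \bar R :=
  ereal_inf [set \sum_(0 <= n <oo) diameter_pow s (U n) |
    U in [set U : nat -> set R |
      A `<=` \bigcup_n U n /\ forall n, diameter (U n) <= delta%:E]].

Definition hausdorff_measure (s : R) (A : set R) : \bar R :=
  ereal_sup [set hausdorff_premeasure s delta A |
    delta in [set delta : R | (0 < delta)%R]].

Definition hausdorff_dim (A : set R) : \bar R :=
  ereal_inf [set s%:E |
    s in [set s : R | (0 <= s)%R /\ hausdorff_measure s A = 0]].

Definition measure_hausdorff_dim
    (mu : probability (measurableTypeR R) R) : \bar R :=
  ereal_inf [set hausdorff_dim B |
    B in [set B : set (measurableTypeR R) | measurable B /\ mu B = 1]].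

End hausdorff_dimension.

(* Borel probability measures on [0,1] are represented as Borel probability
   measures on the line giving mass 1 to [0,1]. *)
Definition on_unit_interval (R : realType)
    (mu : probability (measurableTypeR R) R) : Prop :=
  mu `[0, 1]%classic = 1%E.

Definition contraction (R : realType) (N : nat) (i : 'I_N) (z : R) : R :=
  (z + i%:R) / N%:R.

Definition self_similar_family (R : realType) (N : nat)
    (H G : 'I_N -> R -> R)
    (mu : R -> probability (measurableTypeR R) R) : Prop :=
  forall y : R, 0 <= y <= 1 ->
    on_unit_interval (mu y) /\
    forall A : set (measurableTypeR R), measurable A ->
      mu y A = (\sum_(i < N) (G i y)%:E *
        pushforward (mu (H i y))
          (contraction i : measurableTypeR R -> measurableTypeR R) A)%E.

Definition self_similar_measure (R : realType) (N : nat) (p : 'I_N -> R)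
    (nu : probability (measurableTypeR R) R) : Prop :=
  on_unit_interval nu /\
  forall A : set (measurableTypeR R), measurable A ->
    nu A = (\sum_(i < N) (p i)%:E *
      pushforward nu
        (contraction i : measurableTypeR R -> measurableTypeR R) A)%E.

Definition distribution_function (R : realType)
    (mu : probability (measurableTypeR R) R) (x : R) : R :=
  fine (mu `]-oo, x]%classic).

(* Derivative of [f] as a function on [0,1], hence one-sided at 0 and 1. *)
Definition has_nonzero_derivative (R : realType) (f : R -> R) (x : R) : Prop :=
  exists2 c : R, c != 0 &
    (f z - f x) / (z - x) @[z --> within `[0, 1] x^'] --> c.

Definition near_uniform (R : realType) (N : nat) (eps : R) : set R :=
  `[N%:R^-1 - eps, N%:R^-1 + eps].

Section orbits.
Context {R : realType} {N : nat}.
Implicit Types (H G : 'I_N -> R -> R) (w : seq 'I_N).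

(* For [w = [:: i_1; ...; i_l]] this is [H i_l (... (H i_1 y))]. *)
Definition compose_word H w (y : R) : R := foldl (fun z i => H i z) y w.

Definition orbit_set H (y : R) : set R :=
  [set compose_word H w y | w in [set w : seq 'I_N | (0 < size w)%N]].

Definition Sep H G (y eps : R) w : Prop :=
  orbit_set H y
    `&` \bigcap_(i : 'I_N) (G i @^-1` near_uniform N eps)
    `&` \bigcap_(j : 'I_N) ((G j \o compose_word H w) @^-1` near_uniform N eps)
  = set0.

Definition orbit_weights H G (y : R) : set R :=
  [set G iw.1 iw.2 | iw in [set: 'I_N] `*` orbit_set H y].

End orbits.

(* Main.v *)
Require Import Defs.
From mathcomp Require Import measurable_realfun ring lra.

(** Since [mu y] has no atoms, the mass of the N-adic cylinder of a word [u] is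
    the product of the weights [G] along the orbit segment of [y] coded by [u].

    If the distribution function has derivative [c != 0] at [x], the masses of
    long cylinders around [x] and of their children are asymptotic to [c] times
    their lengths, so [G i (H_u y)] tends to [1 / N].  This contradicts [Sep]
    with the word [w] as soon as [x] lies in the cylinders of [u ++ w] for
    arbitrarily long [u]: always so if every [w] of length [l] is admissible, and
    almost surely for a self-similar measure with positive weights.

    For the dimension, consider the sum of the square roots of the masses of the
    cylinders of level [n], which is at most [sqrt N ^ n] by Cauchy-Schwarz.  At
    each orbit point [Sep] forces a weight far from [1 / N] either at once or
    after [l] steps along a word of mass bounded below, so each block of [l + 1]
    levels loses a fixed factor.  Hence most of the mass of [mu y] is carried by
    exponentially fewer than [N ^ n] cylinders of level [n], and the limsup of
    these families has full measure and dimension less than 1. *)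

Set Implicit Arguments.
Unset Strict Implicit.
Unset Printing Implicit Defensive.

(** * Words of a given length and sums over them *)

Section words.
Context {N : nat}.

Fixpoint words (n : nat) : seq (seq 'I_N) :=
  if n is m.+1 then [seq i :: w | i <- enum 'I_N, w <- words m] else [:: [::]].

Lemma mem_words n (w : seq 'I_N) : (w \in words n) = (size w == n).
Proof.
elim: n w => [|n IHn] [|i w] //=.
- by apply/negbTE/negP => /allpairsP[] [i w] [].
- rewrite eqSS -IHn; apply/allpairsP/idP => [[[j v] /= [_ vn [_ ->]]]//|wn].
  by exists (i, w); split; rewrite //= mem_enum.
Qed.

Lemma sum_words0 (V : nmodType) (f : seq 'I_N -> V) :
  \sum_(w <- words 0) f w = f [::].
Proof. by rewrite big_seq1. Qed.

Lemma sum_wordsS (V : nmodType) n (f : seq 'I_N -> V) :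
  \sum_(w <- words n.+1) f w = \sum_(i < N) \sum_(w <- words n) f (i :: w).
Proof. by rewrite /= big_allpairs_dep big_enum. Qed.

End words.

(** * Weights of words and their affinity with the uniform weights *)

Section affinity.
Context {R : realType} {N : nat} (H G : 'I_N -> R -> R).
Implicit Types (w : seq 'I_N) (z : R) (i : 'I_N).

Fixpoint word_weight w z : R :=
  if w is i :: v then G i z * word_weight v (H i z) else 1.

(* The Bhattacharyya affinity between the level-[n] weights and the uniform
   ones, up to the factor [sqrt N ^- n]. *)
Definition affinity n z : R :=
  \sum_(w <- words n) Num.sqrt (word_weight w z).

Context (H_unit : forall i (z : R), 0 <= z <= 1 -> 0 <= H i z <= 1)
  (G_unit : forall i (z : R), 0 <= z <= 1 -> 0 <= G i z <= 1)
  (G_sum : forall z : R, 0 <= z <= 1 -> \sum_(i < N) G i z = 1)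
  (N_gt0 : (0 < N)%N).

Local Notation c := (Num.sqrt N%:R : R).

Lemma compose_word_unit w z : 0 <= z <= 1 -> 0 <= compose_word H w z <= 1.
Proof. by elim: w z => //= i w IHw z /(H_unit i); apply: IHw. Qed.

Lemma word_weight_ge0 w z : 0 <= z <= 1 -> 0 <= word_weight w z.
Proof.
elim: w z => //= i w IHw z hz; apply: mulr_ge0; last exact/IHw/H_unit.
by case/andP: (G_unit i hz).
Qed.

Lemma word_weight_cat u v z :
  word_weight (u ++ v) z = word_weight u z * word_weight v (compose_word H u z).
Proof. by elim: u z => [|i u IHu] z /=; rewrite ?mul1r// IHu mulrA. Qed.

Lemma sum_word_weight n z : 0 <= z <= 1 -> \sum_(w <- words n) word_weight w z = 1.
Proof.
elim: n z => [|n IHn] z hz; first by rewrite sum_words0.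
rewrite sum_wordsS -(G_sum hz); apply: eq_bigr => i _ /=.
by rewrite -big_distrr /= IHn ?mulr1//; exact: H_unit.
Qed.

(** The weights at each point average [1 / N], so some letter has at least that weight. This
    supplies words of mass bounded below when the weights themselves have no positive lower
    bound. *)
Lemma word_weight_exists n z : 0 <= z <= 1 ->
  exists2 w, size w = n & N%:R^-1 ^+ n <= word_weight w z.
Proof.
elim: n z => [|n IHn] z hz; first by exists [::]; rewrite //= expr0.
have [i hi] : exists i, N%:R^-1 <= G i z.
  apply/existsP; apply: contraT; rewrite negb_exists => /forallP small.
  suff: \sum_(i < N) G i z < \sum_(i < N) N%:R^-1 :> R.
    by rewrite G_sum// sumr_const card_ord -[ltRHS]mulr_natr mulVf ?ltxx// pnatr_eq0 -lt0n.
  apply: ltr_sum; last by move=> i _; rewrite ltNge small.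
  by apply/hasP; exists (Ordinal N_gt0); rewrite ?mem_index_enum.
have [w wn hw] := IHn _ (H_unit i hz).
exists (i :: w); first by rewrite /= wn.
by rewrite exprS /= ler_pM// ?exprn_ge0// invr_ge0.
Qed.

Lemma affinityS n z : 0 <= z <= 1 ->
  affinity n.+1 z = \sum_(i < N) Num.sqrt (G i z) * affinity n (H i z).
Proof.
move=> hz; rewrite /affinity sum_wordsS; apply: eq_bigr => i _ /=.
rewrite big_distrr /=; apply: eq_bigr => w _.
by rewrite sqrtrM//; case/andP: (G_unit i hz).
Qed.

Lemma affinity0 z : affinity 0 z = 1.
Proof. by rewrite /affinity sum_words0 sqrtr1. Qed.

Lemma affinity_ge0 n z : 0 <= affinity n z.
Proof. by apply: sumr_ge0 => w _; exact: sqrtr_ge0. Qed.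

Lemma sqrtN_gt0 : 0 < c.
Proof. by rewrite sqrtr_gt0 ltr0n. Qed.

(** The exact deficit in Cauchy-Schwarz: expanded with [\sum_(i < N) G i z = 1] and
    [N / c ^+ 2 = 1], the squares sum to [2 - 2 / c * affinity 1 z]. *)
Lemma affinity1 z : 0 <= z <= 1 ->
  affinity 1 z = c - c / 2 * \sum_(i < N) (Num.sqrt (G i z) - c^-1) ^+ 2.
Proof.
move=> hz; have c0 := sqrtN_gt0; have c2 : c ^+ 2 = N%:R by rewrite sqr_sqrtr.
have -> : affinity 1 z = \sum_(i < N) Num.sqrt (G i z).
  by rewrite affinityS//; apply: eq_bigr => i _; rewrite affinity0 mulr1.
have -> : \sum_(i < N) (Num.sqrt (G i z) - c^-1) ^+ 2
        = \sum_(i < N) (G i z + (- (2 / c) * Num.sqrt (G i z) + (c ^+ 2)^-1)).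
  apply: eq_bigr => i _; rewrite sqrrB sqr_sqrtr ?exprVn; last by case/andP: (G_unit i hz).
  by rewrite -addrA mulrC -mulr_natl; congr (_ + (_ + _)); ring.
rewrite !big_split /= G_sum// sumr_const card_ord -mulr_sumr -[(c ^+ 2)^-1 *+ N]mulr_natr c2.
rewrite mulVf ?pnatr_eq0 -?lt0n//.
by field; rewrite gt_eqF.
Qed.

Lemma affinity1_le z : 0 <= z <= 1 -> affinity 1 z <= c.
Proof.
move=> hz; rewrite affinity1// gerBl mulr_ge0 ?divr_ge0 ?sqrtr_ge0//.
by apply: sumr_ge0 => i _; exact: sqr_ge0.
Qed.

(** With [r] the square root of the weight, [G i z - 1 / N] factors as [(r - 1 / c) (r + 1 / c)],
    where the second factor is at most 2. Hence [|r - 1 / c| >= e / 2], and the deficit is at least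
    [c / 2] times [e ^+ 2 / 4]. *)
Lemma affinity1_gap z (e : R) i : 0 <= z <= 1 -> 0 < e ->
  ~ near_uniform N e (G i z) -> affinity 1 z <= c - c * e ^+ 2 / 8.
Proof.
move=> hz e0 far; have c0 := sqrtN_gt0.
have ci0 : 0 < c^-1 by rewrite invr_gt0.
have c2 : c^-1 ^+ 2 = N%:R^-1 by rewrite exprVn sqr_sqrtr.
have ci1 : c^-1 <= 1.
  by rewrite invf_le1// -{1}sqrtr1 ler_sqrt ?ler1n.
have /andP[g0 g1] := G_unit i hz.
set r := Num.sqrt (G i z).
have r2 : r ^+ 2 = G i z by rewrite sqr_sqrtr.
have r0 : 0 <= r by exact: sqrtr_ge0.
have r1 : r <= 1 by rewrite -(@sqrtr1 R) ler_sqrt.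
rewrite affinity1// lerD2l lerN2.
have gap : e <= `|r - c^-1| * 2.
  have : e < `|G i z - N%:R^-1|.
    rewrite ltNge; apply/negP => near; apply: far.
    by rewrite /near_uniform /= in_itv /= -ler_distl.
  rewrite -r2 -c2 subr_sqr normrM => /ltW/le_trans; apply.
  by rewrite ler_wpM2l// ger0_norm; lra.
have : e ^+ 2 <= (r - c^-1) ^+ 2 * 4.
  rewrite -(real_normK (num_real (r - c^-1))).
  have -> : `|r - c^-1| ^+ 2 * 4 = (`|r - c^-1| * 2) ^+ 2 by ring.
  by rewrite lerXn2r// nnegrE; [exact: ltW | rewrite mulr_ge0].
have : (r - c^-1) ^+ 2 <= \sum_(j < N) (Num.sqrt (G j z) - c^-1) ^+ 2.
  by rewrite (bigD1 i)//= lerDl sumr_ge0// => j _; exact: sqr_ge0.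
by move=> le1 le2; nra.
Qed.

Lemma affinity_le n z : 0 <= z <= 1 -> affinity n z <= c ^+ n.
Proof.
elim: n z => [|n IHn] z hz; first by rewrite affinity0.
rewrite affinityS// exprS; apply: le_trans (ler_wpM2r _ (affinity1_le hz)).
  rewrite affinityS// mulr_suml ler_sum// => i _.
  by rewrite affinity0 mulr1 ler_wpM2l ?sqrtr_ge0//; exact/IHn/H_unit.
by rewrite exprn_ge0// sqrtr_ge0.
Qed.

(** The deficit [k] at the end of [w] is carried back letter by letter, each time multiplied by the
    square root of that letter's weight; the other branches are bounded by [affinity_le]. *)
Lemma affinity_word_gap w z (k : R) : 0 <= z <= 1 ->
  affinity 1 (compose_word H w z) <= c - k ->
  affinity (size w).+1 z <= c ^+ (size w).+1 - k * Num.sqrt (word_weight w z).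
Proof.
elim: w z => [|i w IHw] z hz; first by rewrite /= sqrtr1 mulr1.
move=> /(IHw _ (H_unit i hz)) {}IHw; rewrite affinityS//= sqrtrM; last first.
  by case/andP: (G_unit i hz).
set n := (size w).+1 in IHw *.
have bound : \sum_(j < N) Num.sqrt (G j z) * affinity n (H j z) <=
    \sum_(j < N) Num.sqrt (G j z) * c ^+ n
      - Num.sqrt (G i z) * (k * Num.sqrt (word_weight w (H i z))).
  rewrite (bigD1 i)//= [X in _ <= X - _](bigD1 i)//= [leRHS]addrAC -mulrBr.
  rewrite lerD ?ler_wpM2l ?sqrtr_ge0// ler_sum// => j _.
  by rewrite ler_wpM2l ?sqrtr_ge0// affinity_le//; exact: H_unit.
apply: (le_trans bound); rewrite mulrCA lerD2r exprS -mulr_suml ler_wpM2r ?exprn_ge0 ?sqrtr_ge0//.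
have := affinity1_le hz; rewrite affinityS//.
by under eq_bigr do rewrite affinity0 mulr1.
Qed.

(** [P] is stable under the maps [H], so the bound [M] holds wherever the first [n] letters lead. It
    will be the unit interval or the orbit of [y]. *)
Lemma affinityD_le (P : set R) n m (M : R) z :
  (forall t, P t -> 0 <= t <= 1) -> (forall i t, P t -> P (H i t)) ->
  (forall t, P t -> affinity m t <= M) ->
  P z -> affinity (n + m) z <= affinity n z * M.
Proof.
move=> P_unit P_H le_M; elim: n z => [|n IHn] z Pz.
  by rewrite affinity0 mul1r; exact: le_M.
rewrite addSn !affinityS; try exact: P_unit.
rewrite mulr_suml ler_sum// => i _; rewrite -mulrA ler_wpM2l ?sqrtr_ge0//.
exact/IHn/P_H.
Qed.

Lemma affinity_block (P : set R) L (M : R) k z :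
  (forall t, P t -> 0 <= t <= 1) -> (forall i t, P t -> P (H i t)) ->
  (forall t, P t -> affinity L t <= M) -> 0 <= M ->
  P z -> affinity (k * L) z <= M ^+ k.
Proof.
move=> P_unit P_H le_M M0; elim: k z => [|k IHk] z Pz; first by rewrite affinity0.
rewrite mulSn exprS; apply: le_trans (affinityD_le L P_unit P_H IHk Pz) _.
by rewrite ler_wpM2r ?exprn_ge0// le_M.
Qed.

End affinity.

(** * N-adic contractions and cylinders *)

Section cylinders.
Context {R : realType} {N : nat} (N_gt0 : (0 < N)%N).
Implicit Types (u v w : seq 'I_N) (x : R) (i : 'I_N).

(** The first letter acts outermost here but innermost in [compose_word], so appending letters
    shrinks the cylinder and advances along the orbit. *)
Definition word_contraction w x : R := foldr (@contraction R N) x w.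

Definition cylinder w : set R :=
  `[word_contraction w 0, word_contraction w 1]%classic.

Let N_gt0R : 0 < N%:R :> R. Proof. by rewrite ltr0n. Qed.

Lemma contraction_inj i : injective (@contraction R N i).
Proof.
by move=> x z /(mulIf (invr_neq0 (lt0r_neq0 N_gt0R)))/addIr.
Qed.

Lemma le_contraction i : {mono (@contraction R N i) : x z / x <= z}.
Proof. by move=> x z; rewrite ler_pM2r ?invr_gt0// lerD2r. Qed.

Lemma contraction_unit i x : 0 <= x <= 1 -> 0 <= contraction i x <= 1.
Proof.
case/andP=> x0 x1; rewrite divr_ge0 ?addr_ge0//= ler_pdivrMr// mul1r.
by rewrite (le_trans (lerD x1 (lexx _)))// addrC natr1 ler_nat.
Qed.

Lemma contraction_onto x : 0 <= x <= 1 ->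
  exists i, exists2 z, 0 <= z <= 1 & x = contraction i z.
Proof.
(* At 1 truncating [x * N] would give the non-digit [N]; the last letter is used instead. *)
move=> /andP[x0]; rewrite le_eqVlt => /predU1P[->|x1].
  have ltp : (N.-1 < N)%N by rewrite prednK.
  exists (Ordinal ltp), 1; rewrite ?ler01 ?lexx//.
  by rewrite /contraction /= addrC natr1 prednK// divff// gt_eqF.
have xN0 : 0 <= x * N%:R by rewrite mulr_ge0.
have /andP[lo /ltW hi] := truncn_itv xN0.
have ltp : (Num.truncn (x * N%:R) < N)%N.
  by rewrite -(ltr_nat R) (le_lt_trans lo)// gtr_pMl.
exists (Ordinal ltp), (x * N%:R - (Num.truncn (x * N%:R))%:R).
  by rewrite subr_ge0 lo /= lerBlDr addrC natr1.
by rewrite /contraction subrK mulfK// gt_eqF.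
Qed.

Lemma word_contraction_cat u v x :
  word_contraction (u ++ v) x = word_contraction u (word_contraction v x).
Proof. by rewrite /word_contraction foldr_cat. Qed.

Lemma word_contraction_unit w x : 0 <= x <= 1 -> 0 <= word_contraction w x <= 1.
Proof. by move=> hx; elim: w => //= i w; exact: contraction_unit. Qed.

Lemma le_word_contraction w : {mono word_contraction w : x z / x <= z}.
Proof. by elim: w => [|i w IHw] x z //=; rewrite le_contraction. Qed.

Lemma word_contractionB w x z :
  word_contraction w z - word_contraction w x = N%:R^-1 ^+ size w * (z - x).
Proof.
elim: w => [|i w IHw] /=; first by rewrite mul1r.
by rewrite exprS -mulrA -IHw /contraction; ring.
Qed.

Lemma cylinder_word_contraction w x : 0 <= x <= 1 -> cylinder w (word_contraction w x).
Proof. by move=> hx; rewrite /cylinder /= in_itv /= !le_word_contraction. Qed.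

Lemma cylinder_catl u v : cylinder (u ++ v) `<=` cylinder u.
Proof.
move=> x; rewrite /cylinder /= !in_itv /= !word_contraction_cat => /andP[x0 x1].
have /andP[a0 _] : 0 <= word_contraction v 0 <= 1.
  by rewrite word_contraction_unit// lexx ler01.
have /andP[_ a1] : 0 <= word_contraction v 1 <= 1.
  by rewrite word_contraction_unit// lexx ler01.
apply/andP; split.
  by apply: le_trans x0; rewrite le_word_contraction.
by apply: (le_trans x1); rewrite le_word_contraction.
Qed.

Lemma cylinder_unit w x : cylinder w x -> 0 <= x <= 1.
Proof. by move/(@cylinder_catl [::] w); rewrite /cylinder /= in_itv. Qed.

Lemma cylinder_diff w x z : cylinder w x -> cylinder w z ->
  `|z - x| <= N%:R^-1 ^+ size w.
Proof.
rewrite /cylinder /= !in_itv /= => /andP[x0 x1] /andP[z0 z1].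
have := word_contractionB w 0 1; rewrite subr0 mulr1 => <-.
by rewrite ler_distl; apply/andP; split; lra.
Qed.

Lemma preimage_word_contraction u w :
  word_contraction u @^-1` cylinder (u ++ w) = cylinder w.
Proof.
apply/seteqP; split => x; rewrite /cylinder /= !in_itv /=;
  by rewrite !word_contraction_cat !le_word_contraction.
Qed.

Lemma cylinder_exists n x : 0 <= x <= 1 -> exists2 w, size w = n & cylinder w x.
Proof.
elim: n x => [|n IHn] x hx; first by exists [::]; rewrite // /cylinder /= in_itv.
have [i [z hz ->]] := contraction_onto hx.
have [w wn wz] := IHn z hz; exists (i :: w); first by rewrite /= wn.
by move: wz; rewrite -(preimage_word_contraction [:: i] w).
Qed.

(** If [i < j], then [x + j <= i + 1] forces [x = 0]; if [j < i], then [i <= x + j] forces [x = 1].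
    Closed cylinders thus overlap only at endpoints, which are null without atoms. *)
Lemma preimage_cylinder_neq i j w : j != i ->
  contraction j @^-1` cylinder (i :: w) `&` `[0, 1] `<=` [set 0; 1].
Proof.
move=> ji x [/(@cylinder_catl [:: i]) ]; rewrite /cylinder /= !in_itv /=.
rewrite /contraction !ler_pM2r ?invr_gt0// add0r => /andP[ix xi] /andP[x0 x1].
have [lt|lt|eq] := ltngtP (nat_of_ord i) (nat_of_ord j).
- by left; apply/eqP; move: lt; rewrite eq_le x0 andbT -(ler_nat R) -natr1; lra.
- by right; apply/eqP; move: lt; rewrite eq_le x1 -(ler_nat R) -natr1 /=; lra.
- by move: ji; rewrite -(inj_eq val_inj) /= eq eqxx.
Qed.

Lemma measurable_contraction i :
  measurable_fun setT (contraction i : measurableTypeR R -> measurableTypeR R).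
Proof. by apply: measurable_funM => //; exact: measurable_funD. Qed.

Lemma measurable_cylinder w : measurable (cylinder w : set (measurableTypeR R)).
Proof. exact: measurable_itv. Qed.

End cylinders.

(** * Measures on the unit interval and masses of cylinders *)

Section unit_interval_measures.
Context {R : realType}.
Implicit Types (m : probability (measurableTypeR R) R) (A B : set (measurableTypeR R)).

Lemma on_unit_interval_le m A B : on_unit_interval m ->
  measurable A -> measurable B -> A `&` `[0, 1] `<=` B -> (m A <= m B)%E.
Proof.
move=> m1 mA mB AB; have mI : measurable (`[0, 1]%classic : set (measurableTypeR R)).
  exact: measurable_itv.
have mC : m (~` `[0, 1]%classic) = 0%E.
  by rewrite probability_setC// m1 subee.
have -> : m A = m (A `&` `[0, 1]).
  rewrite -[in LHS](setIT A) -(setvU `[0, 1]%classic) setIUr setUC measureU0//.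
  - exact: measurableI.
  - by apply: measurableI => //; exact: measurableC.
  - apply/eqP; rewrite -measure_le0 -mC le_measure ?inE//.
    + by apply: measurableI => //; exact: measurableC.
    + exact: measurableC.
by apply: le_measure => //; rewrite inE//; exact: measurableI.
Qed.

End unit_interval_measures.

Section self_similar_family.

Context {R : realType} {N : nat} (N_gt0 : (0 < N)%N) (H G : 'I_N -> R -> R).
Context (H_unit : forall i (z : R), 0 <= z <= 1 -> 0 <= H i z <= 1)
  (G_unit : forall i (z : R), 0 <= z <= 1 -> 0 <= G i z <= 1).
Context (mu : R -> probability (measurableTypeR R) R)
  (mu_eq : self_similar_family H G mu).

(** All terms of the self-similarity equation being nonnegative, an atom of [mu (H i z)] at [x]
    would give one of [mu z] at [contraction i x]. *)
Lemma no_atoms_step (z : R) i : 0 <= z <= 1 ->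
  (forall x, mu z [set x] = 0%E) -> G i z != 0 ->
  forall x, mu (H i z) [set x] = 0%E.
Proof.
move=> hz na G0 x; have [_ /(_ [set contraction i x])] := mu_eq hz.
rewrite na (bigD1 i)//= => /(_ (measurable_set1 _))/esym/eqP.
have ge0 j A : (0 <= (G j z)%:E * mu (H j z) A)%E.
  by rewrite mule_ge0// lee_fin; case/andP: (G_unit j hz).
rewrite padde_eq0; [|exact: ge0|]; last first.
  by apply: sume_ge0 => j _; exact: ge0.
rewrite mule_eq0 eqe (negbTE G0) /= => /andP[/eqP mux _]; rewrite -[RHS]mux.
congr (mu _ _).
by apply/seteqP; split => [t ->|t /(contraction_inj N_gt0)].
Qed.

Lemma measure_cylinder w (z : R) : 0 <= z <= 1 ->
  (forall x, mu z [set x] = 0%E) ->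
  mu z (cylinder w) = (word_weight H G w z)%:E.
Proof.
elim: w z => [|i w IHw] z hz na.
  by have [+ _] := mu_eq hz.
have [_ ->] := mu_eq hz; last exact: measurable_cylinder.
rewrite (bigD1 i)//= big1 ?adde0 => [|j ji].
  (* For a zero weight [mu (H i z)] may have atoms, but then both sides vanish. *)
  have [->|G0] := eqVneq (G i z) 0; first by rewrite mul0e mul0r.
  have := IHw _ (H_unit i hz) (no_atoms_step hz na G0); rewrite EFinM => <-.
  by congr (_ * mu _ _)%E; exact: (preimage_word_contraction N_gt0 [:: i]).
have [->|G0] := eqVneq (G j z) 0; first by rewrite mul0e.
have na' := no_atoms_step hz na G0; have [mu1 _] := mu_eq (H_unit j hz).
rewrite /pushforward; apply/eqP; rewrite mule_eq0 -measure_le0; apply/orP; right.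
apply: le_trans (on_unit_interval_le mu1 _ _ (preimage_cylinder_neq N_gt0 ji)) _.
- rewrite -[_ @^-1` _]setTI; apply: measurable_contraction => //.
  exact: measurable_cylinder.
- by apply: measurableU; exact: measurable_set1.
- rewrite (@measureU0 _ _ _ (mu (H j z)))//; last exact: na'.
  by rewrite measure_le0; apply/eqP; exact: na'.
Qed.

End self_similar_family.

(** * Weights near a point of nonzero derivative *)

Section nonzero_derivative.
Context {R : realType}.

Lemma distribution_functionB (m : probability (measurableTypeR R) R) (a b : R) :
  a <= b -> m [set a] = 0%E ->
  distribution_function m b - distribution_function m a = fine (m `[a, b]%classic).
Proof.
move=> ab ma; have mI := @measurable_itv R.
have fin A : measurable A -> m A \is a fin_num := fin_num_measure m A.
have -> : m `[a, b]%classic = m `]a, b]%classic.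
  rewrite -(@setU1itv _ _ _ _ false) ?bnd_simp// measureU//.
    by rewrite [X in (X + _)%E]ma add0e.
  by apply/seteqP; split => // x [/= ->]; rewrite in_itv /= ltxx.
have -> : distribution_function m b = distribution_function m a + fine (m `]a, b]%classic).
  rewrite /distribution_function -fineD ?fin// -measureU//.
    congr (fine (m _)); apply/seteqP; split => x; rewrite /= !in_itv /=.
      by move=> xb; case: (leP x a) => xa; [left|right].
    by case=> [/le_trans->//|/andP[]].
  apply/seteqP; split => // x []; rewrite /= !in_itv /= => xa /andP[+ _].
  by rewrite ltNge xa.
by rewrite addrC addKr.
Qed.

(** Multiplying by [z - x] makes the estimate valid at [z = x] too, as needed when [x] is an
    endpoint of a cylinder. *)
Lemma derivative_increment (f : R -> R) (x c e : R) :
  (f z - f x) / (z - x) @[z --> within `[0, 1] x^'] --> c -> 0 < e ->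
  exists2 r : R, 0 < r & forall z : R, 0 <= z <= 1 -> `|z - x| < r ->
    `|f z - f x - c * (z - x)| <= e * `|z - x|.
Proof.
move=> /cvgrPdist_le/(_ e)/[apply].
rewrite near_withinE /dnbhs near_withinE => /nbhs_ballP[r /= r0 near].
exists r => // z hz zx.
have [->|zx0] := eqVneq z x; first by rewrite !subrr mulr0 subr0 normr0 mulr0.
have := near z; rewrite /ball /= distrC => /(_ zx zx0).
rewrite /= in_itv /= => /(_ hz).
have d0 : 0 < `|z - x| by rewrite normr_gt0 subr_eq0.
rewrite -(ler_pM2r d0) -normrM mulrBl divfK ?subr_eq0//.
by rewrite distrC.
Qed.

Lemma expr_small (q r : R) : 0 <= q < 1 -> 0 < r ->
  exists m, forall n, (m <= n)%N -> q ^+ n < r.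
Proof.
move=> /andP[q0 q1] r0; have : GRing.exp q @ \oo --> (0 : R).
  by apply: cvg_expr; rewrite ger0_norm.
move=> /cvgrPdist_lt/(_ r r0)[m _ hm]; exists m => n /hm /=.
by rewrite sub0r normrN ger0_norm// exprn_ge0.
Qed.

Lemma invN_itv (N : nat) : (1 < N)%N -> 0 <= (N%:R^-1 : R) < 1.
Proof. by move=> N1; rewrite invr_ge0 ler0n invf_lt1 ?ltr1n// ltr0n ltnW. Qed.

Context {N : nat} (N_gt1 : (1 < N)%N) (H G : 'I_N -> R -> R).
Context (H_unit : forall i (z : R), 0 <= z <= 1 -> 0 <= H i z <= 1)
  (G_unit : forall i (z : R), 0 <= z <= 1 -> 0 <= G i z <= 1).
Context (mu : R -> probability (measurableTypeR R) R)
  (mu_eq : self_similar_family H G mu).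
Context (y : R) (hy : 0 <= y <= 1) (mu_no_atoms : forall x : R, mu y [set x] = 0%E).

(* Both the mass of [cylinder u] and that of its children are [c] times their
   length, up to an error that is small compared to the length. *)
Lemma weights_near_uniform (x e : R) : 0 <= x <= 1 -> 0 < e ->
  has_nonzero_derivative (distribution_function (mu y)) x ->
  exists m, forall u, (m <= size u)%N -> cylinder u x ->
    forall i, near_uniform N e (G i (compose_word H u y)).
Proof.
move=> hx e0 [c c0 /derivative_increment dc].
have N_gt0 : (0 < N)%N by exact: ltnW.
have nc0 : 0 < `|c| by rewrite normr_gt0.
(* The factor 4 pays for two masses, of the cylinder and of its child, each with an error at two
   endpoints. *)
have eta0 : 0 < `|c| * e / 4 by rewrite divr_gt0// mulr_gt0.
have [r r0 dr] := dc _ eta0; have [m hm] := expr_small (invN_itv N_gt1) r0.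
exists m => u mu_u xu i; set g := G i _.
have /andP[g0 g1] : 0 <= g <= 1 by rewrite G_unit// compose_word_unit.
set d : R := N%:R^-1 ^+ size u; set f := distribution_function (mu y) in dr *.
have d0 : 0 < d by rewrite exprn_gt0// invr_gt0 ltr0n.
set eta : R := `|c| * e / 4 in dr eta0.
have near t : cylinder u t -> `|f t - f x - c * (t - x)| <= eta * d.
  move=> ut; have td := cylinder_diff xu ut.
  apply: le_trans (dr t (cylinder_unit N_gt0 ut) (le_lt_trans td (hm _ mu_u))) _.
  by rewrite ler_wpM2l// ltW.
have mass v : `|word_weight H G (u ++ v) y - c * N%:R^-1 ^+ size (u ++ v)| <= 2 * (eta * d).
  have le01 : word_contraction (u ++ v) 0 <= word_contraction (u ++ v) (1 : R).
    by rewrite le_word_contraction.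
  have := distribution_functionB le01 (mu_no_atoms _).
  rewrite -/(cylinder (u ++ v))
    (measure_cylinder N_gt0 H_unit G_unit mu_eq _ hy mu_no_atoms) /= => <-.
  rewrite -/f -[X in c * X]mulr1 -[X in c * (_ * X)]subr0 -word_contractionB//.
  set b := word_contraction _ 1; set a := word_contraction _ 0.
  have nb : `|f b - f x - c * (b - x)| <= eta * d.
    apply/near/(cylinder_catl N_gt0 (v := v)).
    by apply: cylinder_word_contraction; rewrite // ler01 lexx.
  have na : `|f a - f x - c * (a - x)| <= eta * d.
    apply/near/(cylinder_catl N_gt0 (v := v)).
    by apply: cylinder_word_contraction; rewrite // ler01 lexx.
  have -> : f b - f a - c * (b - a) =
    (f b - f x - c * (b - x)) - (f a - f x - c * (a - x)) by ring.
  by rewrite (le_trans (ler_normB _ _))// mulr_natl mulr2n lerD.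
have := mass [:: i]; have := mass [::].
rewrite cats0 cats1 size_rcons -cats1 word_weight_cat /= mulr1 -/g -/d exprSr -/d.
set W := word_weight H G u y => W0 W1.
rewrite /near_uniform /= in_itv /= -ler_distl.
have : `|c * d * (g - N%:R^-1)| <= `|c| * d * e.
  (* Comparing the child's mass [W * g] with [g] times the estimate for [W] isolates [g]. *)
  have -> : c * d * (g - N%:R^-1) = (W * g - c * (d / N%:R)) - (W - c * d) * g.
    by ring.
  have bound : `|W - c * d| * g <= 2 * (eta * d) * 1 by rewrite ler_pM.
  apply: le_trans (ler_normB _ _) _; rewrite [`|(_ - _) * g|]normrM (ger0_norm g0).
  by apply: le_trans (lerD W1 bound) _; rewrite /eta; lra.
by rewrite !normrM (gtr0_norm d0) ler_pM2l// mulr_gt0.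
Qed.

End nonzero_derivative.

(** * Recurrence of words under self-similar measures *)

Lemma convex_combination_max (R : realType) (I : finType) (p a : I -> R) (b : R) :
  (forall i, 0 < p i) -> \sum_i p i = 1 -> (forall i, a i <= b) ->
  \sum_i p i * a i = b -> forall i, a i = b.
Proof.
move=> p0 p1 ab ab_eq i.
have /eqP : \sum_j p j * (b - a j) = 0.
  under eq_bigr do rewrite mulrBr.
  by rewrite sumrB ab_eq -mulr_suml p1 mul1r subrr.
rewrite psumr_eq0 => [|j _]; last by rewrite mulr_ge0 ?subr_ge0// ltW.
move=> /allP/(_ i (mem_index_enum _)); rewrite /= mulf_eq0 gt_eqF//= subr_eq0.
by move/eqP.
Qed.

Section self_similar_recurrence.
Context {R : realType} {N : nat} (N_gt0 : (0 < N)%N).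
Context (p : 'I_N -> R) (nu : probability (measurableTypeR R) R).
Context (p_gt0 : forall i, 0 < p i) (p_sum : \sum_(i < N) p i = 1)
  (nu_eq : self_similar_measure p nu).
Implicit Types (A B : set (measurableTypeR R)) (u v w : seq 'I_N) (i : 'I_N).

Let mass A : R := fine (nu A).

Let le_mass A B : measurable A -> measurable B -> A `<=` B -> mass A <= mass B.
Proof.
move=> mA mB AB; apply: fine_le; [exact: fin_num_measure..|].
by apply: le_measure; rewrite ?inE.
Qed.

Let measurable_preimage i A : measurable A -> measurable (contraction i @^-1` A).
Proof.
by move=> mA; rewrite -[_ @^-1` _]setTI; exact: measurable_contraction.
Qed.

Let mass_self_similar A : measurable A ->
  mass A = \sum_(i < N) p i * mass (contraction i @^-1` A).
Proof.
move=> mA; have [_ /(_ A mA) nuA] := nu_eq.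
rewrite /mass nuA -sum_fine => [|i _].
  apply: eq_bigr => i _; rewrite fineM ?fin_num_measure//.
  exact: measurable_preimage.
rewrite fin_numM// /pushforward fin_num_measure//.
exact: measurable_preimage.
Qed.

(** The points none of whose codings contains [w] at a position from [m] on. *)
Let avoid w m : set (measurableTypeR R) :=
  \bigcap_(u in [set u | (m <= size u)%N]) ~` cylinder (u ++ w).

Let measurable_avoid w m : measurable (avoid w m).
Proof.
rewrite /avoid -setC_bigcup; apply: measurableC.
rewrite [X in measurable X](_ : _ = \bigcup_u
    if (m <= size u)%N then cylinder (u ++ w) else set0 : set (measurableTypeR R)).
  apply: countable_bigcupT_measurable => // u; case: ifP => // _.
  exact: measurable_cylinder.
apply/seteqP; split => [x [u mu ux]|x [u _]].
  by exists u => //; rewrite (mu : (m <= size u)%N).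
by case: ifP => // mu ux; exists u.
Qed.

Let preimage_avoid w v m : word_contraction v @^-1` avoid w (size v + m) `<=` avoid w m.
Proof.
move=> x vx u mu ux; apply: (vx (v ++ u)); first by rewrite /= size_cat leq_add2l.
by rewrite -catA; move: ux; rewrite -(preimage_word_contraction N_gt0 v).
Qed.

Let avoid_leq w m n : (m <= n)%N -> avoid w m `<=` avoid w n.
Proof. by move=> mn x mx u /(leq_trans mn); exact: mx. Qed.

Let measurable_word_preimage v A : measurable A -> measurable (word_contraction v @^-1` A).
Proof.
by elim: v A => // i v IHv A mA; exact: (IHv _ (measurable_preimage i mA)).
Qed.

(* The preimages of [avoid w 0] under the contractions lie in [avoid w 0], so
   self-similarity forces all of them to have the same mass, whereas the
   preimage under the contraction of [w] is null. *)
Let mass_avoid0 w : mass (avoid w 0) = 0.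
Proof.
have invariant v : mass (word_contraction v @^-1` avoid w 0) = mass (avoid w 0).
  (* Induction on the last letter, because self-similarity applied to a preimage under [v] appends a
     letter on the inside. *)
  elim/last_ind: v => // v i IHv.
  have le_avoid (u : seq 'I_N) : word_contraction u @^-1` avoid w 0 `<=` avoid w 0.
    apply: subset_trans (@preimage_avoid w u 0); apply: preimage_subset.
    exact: avoid_leq.
  have mv := measurable_word_preimage v (measurable_avoid w 0).
  have preE j : contraction j @^-1` (word_contraction v @^-1` avoid w 0)
      = word_contraction (rcons v j) @^-1` avoid w 0.
    by apply/seteqP; split => x /=; rewrite -cats1 word_contraction_cat.
  rewrite -preE; apply: (convex_combination_max
    (a := fun j => mass (contraction j @^-1` (word_contraction v @^-1` avoid w 0)))
    p_gt0 p_sum _ _ i).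
    move=> j; rewrite preE; apply: le_mass; [|exact: measurable_avoid|exact: le_avoid].
    exact: measurable_word_preimage (measurable_avoid w 0).
  by rewrite -mass_self_similar.
rewrite -(invariant w); apply/eqP.
have null : (nu (word_contraction w @^-1` avoid w 0) <= nu set0)%E.
  apply: on_unit_interval_le; first by case: nu_eq.
  - exact: measurable_word_preimage (measurable_avoid w 0).
  - exact: measurable0.
  (* With the empty prefix: [w] sends every point of [[0, 1]] into the excluded cylinder of [w]. *)
  - move=> x [xw]; rewrite /= in_itv /= => hx; apply: (xw [::]) => //=.
    exact: cylinder_word_contraction.
by move: null; rewrite measure0 measure_le0 /mass => /eqP ->.
Qed.

(** The preimages of [avoid w m.+1] under the contractions lie in [avoid w m], so self-similarity
    passes nullity from [m] to [m.+1]. *)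
Let mass_avoid w m : mass (avoid w m) = 0.
Proof.
elim: m => [|m IHm]; first exact: mass_avoid0.
apply/eqP; rewrite eq_le fine_ge0 ?measure_ge0// andbT mass_self_similar//.
rewrite (le_trans (y := \sum_(i < N) p i * mass (avoid w m)))//.
  apply: ler_sum => i _; rewrite ler_pM2l//; apply: le_mass => //.
    exact: measurable_preimage (measurable_avoid w m.+1).
  exact: (@preimage_avoid w [:: i] m).
by rewrite IHm big1// => i _; rewrite mulr0.
Qed.

Lemma self_similar_recurrence w :
  {ae nu, forall x, forall m, exists2 u, (m <= size u)%N & cylinder (u ++ w) x}.
Proof.
have : nu.-negligible (\bigcup_m avoid w m).
  apply: negligible_bigcup => m; exists (avoid w m); split => //.
  by apply/eqP; rewrite -fine_eq0 ?fin_num_measure//; apply/eqP; exact: mass_avoid.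
apply: negligibleS => x /=; rewrite -existsNE => -[m xm]; exists m => //.
by move=> u mu ux; apply: xm; exists u.
Qed.

End self_similar_recurrence.

(** * Hausdorff dimension of limsup sets *)

Section hausdorff_covers.
Context {R : realType}.
Local Open Scope ereal_scope.

(** The terms are nonnegative, and any finite part of the flattened series lies in a rectangle of
    indices. *)
Lemma nneseries_pickle_le (f : nat -> nat -> \bar R) (b : \bar R) :
  (forall k j, 0 <= f k j) ->
  (forall m n, \sum_(0 <= k < m) \sum_(0 <= j < n) f k j <= b) ->
  \sum_(0 <= n <oo) oapp (fun kj : nat * nat => f kj.1 kj.2) 0 (pickle_inv n) <= b.
Proof.
move=> f0 fb; apply: lime_le.
  by apply: is_cvg_ereal_nneg_natsum => n _; case: pickle_inv => /=.
apply: nearW => M; set F := fun kj : nat * nat => f kj.1 kj.2.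
rewrite -(big_pmap _ F).
set s := pmap _ _; have us : uniq s by apply: (pmap_uniq (@pickle_invK _)); exact: iota_uniq.
pose m := (\max_(kj <- s) kj.1).+1; pose n := (\max_(kj <- s) kj.2).+1.
apply: le_trans (fb m n).
pose t := [seq (k, j) | k <- index_iota 0 m, j <- index_iota 0 n].
have -> : \sum_(0 <= k < m) \sum_(0 <= j < n) f k j = \sum_(kj <- t) F kj.
  by rewrite big_allpairs_dep.
have F0 kj : 0 <= F kj by exact: f0.
have ut : uniq t by apply: allpairs_uniq; rewrite ?iota_uniq// => -[? ?] [? ?].
have st : {subset s <= t}.
  move=> [k j] kjs; apply/allpairsP; exists (k, j); split=> //=.
    by rewrite mem_index_iota ltnS
      (@leq_bigmax_seq _ s xpredT (fun p : nat * nat => p.1) _ kjs isT).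
  by rewrite mem_index_iota ltnS
      (@leq_bigmax_seq _ s xpredT (fun p : nat * nat => p.2) _ kjs isT).
rewrite (perm_big [seq kj <- t | kj \in s]); last first.
  apply: (uniq_perm us (filter_uniq _ ut)).
  by move=> kj; rewrite mem_filter; case: (boolP (kj \in s)) => //= /st ->.
by rewrite big_filter big_mkcond; apply: lee_sum => kj _; case: ifP.
Qed.

Lemma sum_nth_le (T : Type) (x0 : T) (s : seq T) (f : T -> \bar R) (b : R) n :
  f x0 = 0 -> (0 <= b)%R -> (forall i, (i < size s)%N -> f (nth x0 s i) <= b%:E) ->
  \sum_(0 <= j < n) f (nth x0 s j) <= ((size s)%:R * b)%:E.
Proof.
move=> f0 b0 fb; apply: (@le_trans _ _ ((minn n (size s))%:R * b)%:E); last first.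
  by rewrite lee_fin ler_wpM2r// ler_nat geq_minr.
elim: n => [|n IHn]; first by rewrite big_geq// min0n mul0r.
rewrite big_nat_recr//=; have [sn|ns] := leqP (size s) n.
  by move: IHn; rewrite nth_default// f0 adde0 (minn_idPr sn) (minn_idPr (leqW sn)).
move: IHn; rewrite (minn_idPl ns) (minn_idPl (ltnW ns)) => IHn.
by rewrite -natr1 mulrDl mul1r EFinD leeD// fb.
Qed.

Lemma diameter_ge0 (A : set R) : 0 <= diameter A.
Proof. by apply: ereal_sup_ubound; left. Qed.

Lemma diameter_set0 : diameter (set0 : set R) = 0.
Proof.
by rewrite /diameter set0X image_set0 setU0 ereal_sup1.
Qed.

Lemma diameter_le (A : set R) (d : R) : (0 <= d)%R ->
  (forall x z, A x -> A z -> (`|x - z| <= d)%R) -> diameter A <= d%:E.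
Proof.
move=> d0 Ad; apply: ge_ereal_sup => _ [->|[[x z] [/= Ax Az] <-]].
  by rewrite lee_fin.
by rewrite lee_fin Ad.
Qed.

Lemma diameter_pow_ge0 s (A : set R) : 0 <= diameter_pow s A.
Proof. by rewrite /diameter_pow; case: ifP => // _; exact: poweR_ge0. Qed.

Lemma diameter_pow_set0 s : diameter_pow s (set0 : set R) = 0.
Proof. by rewrite /diameter_pow asboolT. Qed.

Lemma diameter_pow_le s (A : set R) (d : R) : (0 <= s)%R -> (0 <= d)%R ->
  diameter A <= d%:E -> diameter_pow s A <= (d `^ s)%:E.
Proof.
move=> s0 d0 Ad; rewrite /diameter_pow; case: ifP => [_|_].
  by rewrite lee_fin powR_ge0.
rewrite -poweR_EFin; apply: gt0_ler_poweR => //.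
  by rewrite in_itv /= diameter_ge0 leey.
by rewrite in_itv /= lee_fin d0 leey.
Qed.

(** A Borel-Cantelli argument: the families from level [m] on cover [B] with arbitrarily small
    diameters, and their [s]-powers sum to at most [C / (1 - q) * q ^+ m], so the [s]-dimensional
    measure vanishes. *)
Lemma hausdorff_dim_limsup_le (I : eqType) (U : I -> set R) (fam : nat -> seq I)
    (d : nat -> R) (s C q : R) (B : set R) :
  (0 <= s)%R -> (0 <= C)%R -> (0 <= q < 1)%R -> (forall k, 0 <= d k)%R ->
  d k @[k --> \oo] --> (0%R : R) ->
  (forall k i, i \in fam k -> diameter (U i) <= (d k)%:E) ->
  (forall k, (size (fam k))%:R * d k `^ s <= C * q ^+ k)%R ->
  (forall x, B x -> forall m, exists k, exists i,
    [/\ (m <= k)%N, i \in fam k & U i x]) ->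
  hausdorff_dim B <= s%:E.
Proof.
move=> s0 C0 /andP[q0 q1] d0 d_cvg diamU sizeU coverB.
apply: ereal_inf_lbound; exists s => //; split => //.
apply/eqP; rewrite eq_le; apply/andP; split; last first.
  apply: (@le_trans _ _ (hausdorff_premeasure s 1 B)); last first.
    by apply: ereal_sup_ubound; exists 1%R => /=.
  apply: le_ereal_inf_tmp => _ [V _ <-]; apply: nneseries_ge0 => n _ _.
  exact: diameter_pow_ge0.
apply: ge_ereal_sup => _ [delta /= delta0 <-].
apply/lee_addgt0Pr => e e0; rewrite add0e.
have q1' : (0 < 1 - q)%R by rewrite subr_gt0.
have [m1 d_small] : exists m, forall k, (m <= k)%N -> (d k <= delta)%R.
  move/cvgrPdist_le : d_cvg => /(_ _ delta0)[m _ hm]; exists m => k /hm /=.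
  by rewrite sub0r normrN ger0_norm.
have [m2 q_small] : exists m, forall k, (m <= k)%N -> (C / (1 - q) * q ^+ k <= e)%R.
  have : (fun k => C / (1 - q) * q ^+ k)%R @ \oo --> (C / (1 - q) * 0)%R.
    by apply: cvgMl_tmp; apply: cvg_expr; rewrite ger0_norm.
  rewrite mulr0 => /cvgrPdist_le/(_ _ e0)[m _ hm]; exists m => k /hm /=.
  by rewrite sub0r normrN; apply: le_trans; exact: ler_norm.
pose m := maxn m1 m2.
pose V k j := nth set0 [seq U i | i <- fam (m + k)%N] j.
(* The doubly indexed tail becomes one sequence, padded with empty sets, whose [diameter_pow] is
   0. *)
pose W n := oapp (fun kj : nat * nat => V kj.1 kj.2) set0 (pickle_inv n).
have V_diam k j : V k j = set0 \/ diameter (V k j) <= (d (m + k)%N)%:E.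
  rewrite /V; have [js|js] := ltnP j (size (fam (m + k)%N)); [right|left].
    case E : (fam _) js => [//|i0 r] js.
    by rewrite (nth_map i0)// -E diamU// E mem_nth.
  by rewrite nth_default// size_map.
have le_delta k : (d (m + k)%N <= delta)%R.
  by apply: d_small; rewrite (leq_trans (leq_maxl m1 m2))// leq_addr.
apply: (@le_trans _ _ (\sum_(0 <= n <oo) diameter_pow s (W n))).
  apply: ereal_inf_lbound; exists W => //; split => [x /coverB/(_ m)[k [i [mk ik ix]]]|n].
    exists (pickle (k - m, index i (fam k))%N) => //.
    rewrite /W pickleK_inv /= /V subnKC// (nth_map i) ?index_mem//.
    by rewrite nth_index.
  rewrite /W; case: pickle_inv => [[k j]|] /=; last by rewrite diameter_set0 lee_fin ltW.
  case: (V_diam k j) => [->|]; first by rewrite diameter_set0 lee_fin ltW.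
  by move=> /le_trans; apply; rewrite lee_fin.
pose f k j := diameter_pow s (V k j).
rewrite (_ : (fun _ => _) =
    (fun n => \sum_(0 <= i < n) oapp (fun kj : nat * nat => f kj.1 kj.2) 0 (pickle_inv i))).
  apply: nneseries_pickle_le => [k j|M n]; first exact: diameter_pow_ge0.
  apply: (@le_trans _ _ (\sum_(0 <= k < M) (C * q ^+ (m + k))%:E)).
    apply: lee_sum => k _.
    apply: (@le_trans _ _ ((size (fam (m + k)%N))%:R * d (m + k)%N `^ s)%:E); last first.
      by rewrite lee_fin.
    rewrite -(size_map U); apply: sum_nth_le; rewrite ?powR_ge0//.
      exact: diameter_pow_set0.
    move=> j _; rewrite -/(V k j); case: (V_diam k j) => [->|].
      by rewrite diameter_pow_set0 lee_fin powR_ge0.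
    exact: diameter_pow_le.
  rewrite sumEFin lee_fin big_mkord.
  under eq_bigr do rewrite exprD mulrA.
  rewrite -mulr_sumr; apply: le_trans (q_small m (leq_maxr m1 m2)).
  rewrite [leRHS]mulrAC ler_wpM2l ?mulr_ge0 ?exprn_ge0//.
  rewrite -(ler_pM2l q1') divff ?gt_eqF//.
  have := subrX1 q M; rewrite -opprB -[(q - 1)%R]opprB mulNr => /oppr_inj <-.
  by rewrite gerBl exprn_ge0.
apply/funext => n; apply: eq_bigr => i _; rewrite /W /f.
by case: pickle_inv => //=; rewrite diameter_pow_set0.
Qed.

End hausdorff_covers.

(** * From decay of the affinity to the dimension of the measure *)

Lemma measure_bigsetU_le d (T : measurableType d) (R : realType)
    (m : {measure set T -> \bar R}) (I : Type) (s : seq I) (P : pred I) (F : I -> set T) :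
  (forall i, measurable (F i)) ->
  (m (\big[setU/set0]_(i <- s | P i) F i) <= \sum_(i <- s | P i) m (F i))%E.
Proof.
move=> mF; elim: s => [|i s IHs]; first by rewrite !big_nil measure0.
rewrite !big_cons; case: ifP => // _.
apply: le_trans (measureU2 _ _ _) _ => //; first exact: bigsetU_measurable.
exact: leeD.
Qed.

Section dimension.
Context {R : realType} {N : nat} (N_gt1 : (1 < N)%N) (H G : 'I_N -> R -> R).
Context (H_unit : forall i (z : R), 0 <= z <= 1 -> 0 <= H i z <= 1)
  (G_unit : forall i (z : R), 0 <= z <= 1 -> 0 <= G i z <= 1)
  (G_sum : forall z : R, 0 <= z <= 1 -> \sum_(i < N) G i z = 1).
Context (mu : R -> probability (measurableTypeR R) R)
  (mu_eq : self_similar_family H G mu).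
Context (y : R) (hy : 0 <= y <= 1) (mu_no_atoms : forall x : R, mu y [set x] = 0%E).

Let N_gt0 : (0 < N)%N. Proof. exact: ltnW. Qed.
Let weight (w : seq 'I_N) : R := word_weight H G w y.
Let weight_ge0 w : 0 <= weight w. Proof. exact: word_weight_ge0. Qed.
Local Notation c := (Num.sqrt N%:R : R).

Definition heavy_words (n : nat) (t : R) : seq (seq 'I_N) :=
  [seq w <- words n | t ^+ 2 <= word_weight H G w y].

(** The weights of all words sum to 1, and each heavy one is at least [t ^+ 2]. *)
Lemma size_heavy_words n t : (size (heavy_words n t))%:R * t ^+ 2 <= 1.
Proof.
rewrite -[leRHS](sum_word_weight H_unit G_sum n hy) (bigID (fun w => t ^+ 2 <= weight w)) /=.
rewrite -[leLHS]addr0; apply: lerD; last by apply: sumr_ge0 => w _; exact: weight_ge0.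
rewrite -big_filter -/(heavy_words n t) mulr_natl -iter_addr_0 -count_predT -big_const_seq.
by rewrite !big_seq; apply: ler_sum => w; rewrite mem_filter => /andP[].
Qed.

(** A light weight is the square of its root, and one of the two factors is bounded by [t]. *)
Let light_weight n t : 0 <= t ->
  \sum_(w <- words n | ~~ (t ^+ 2 <= weight w)) weight w <= t * affinity H G n y.
Proof.
move=> t0; rewrite /affinity mulr_sumr big_mkcond; apply: ler_sum => w _.
case: ifP => [|_]; last by rewrite mulr_ge0// sqrtr_ge0.
rewrite -ltNge => /ltW wt; rewrite -[leLHS](sqr_sqrtr (weight_ge0 w)) expr2.
rewrite ler_wpM2r ?sqrtr_ge0//.
by rewrite -(ger0_norm t0) -sqrtr_sqr ler_wsqrtr.
Qed.

Let heavy n t : set (measurableTypeR R) :=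
  \big[setU/set0]_(w <- heavy_words n t) cylinder w.

Let heavyP n t x : heavy n t x <-> exists2 w, w \in heavy_words n t & cylinder w x.
Proof.
rewrite /heavy -bigcup_seq; split => [[w wn wx]|[w wn wx]]; by exists w.
Qed.

Let measurable_heavy n t : measurable (heavy n t).
Proof. by apply: bigsetU_measurable => w _; exact: measurable_cylinder. Qed.

Let mu_heavyC n t : 0 <= t ->
  (mu y (~` heavy n t) <= (t * affinity H G n y)%:E)%E.
Proof.
move=> t0; have mcyl := @measurable_cylinder R N.
pose light : set (measurableTypeR R) :=
  \big[setU/set0]_(w <- words n | ~~ (t ^+ 2 <= weight w)) cylinder w.
suff: (mu y (~` heavy n t) <= mu y light)%E.
  move/le_trans; apply; apply: le_trans (measure_bigsetU_le _ _ _ mcyl) _.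
  rewrite (eq_bigr (fun w => (weight w)%:E)) => [|w _]; last exact: measure_cylinder.
  by rewrite sumEFin lee_fin light_weight.
have [mu1 _] := mu_eq hy; apply: on_unit_interval_le => //.
- exact: measurableC.
- exact: bigsetU_measurable.
move=> x [xh]; rewrite /= in_itv /= => hx.
have [w wn wx] := cylinder_exists N_gt0 n hx.
rewrite /light -bigcup_seq_cond; exists w => //=.
rewrite mem_words wn eqxx /=; apply/negP => tw; apply: xh; apply/heavyP.
by exists w => //; rewrite mem_filter tw mem_words wn /=.
Qed.

(* Level [1 + k L], and [t ^ 2 = N ^ - level * s ^ - 2 k], where the affinity
   is at most [c ^ level * s ^ 2 k]. *)
Let measure_hausdorff_dim_lt1_sqr (L : nat) (s : R) : (0 < L)%N -> 2^-1 <= s < 1 ->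
  (forall k, affinity H G (k * L).+1 y <= c * (c ^+ L * s ^+ 2) ^+ k) ->
  (measure_hausdorff_dim (mu y) < 1)%E.
Proof.
move=> L0 /andP[s2 s1] aff.
have s0 : 0 < s by apply: lt_le_trans s2; rewrite invr_gt0.
have c0 : 0 < c by exact: sqrtN_gt0.
have N0 : 0 < N%:R :> R by rewrite ltr0n.
have lnN0 : 0 < ln (N%:R : R) by rewrite ln_gt0// ltr1n.
pose n k := (k * L).+1.
pose t k := c^-1 ^+ n k * s^-1 ^+ k.
have t0 k : 0 <= t k by rewrite mulr_ge0// exprn_ge0// invr_ge0 ltW.
have t_aff k : t k * affinity H G (n k) y <= s ^+ k.
  apply: le_trans (ler_wpM2l (t0 k) (aff k)) _; rewrite /t /n exprS mulnC exprM.
  rewrite exprMn [s ^+ 2 ^+ k]exprAC !exprVn le_eqVlt; apply/orP; left; apply/eqP.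
  by field; rewrite !gt_eqF ?exprn_gt0.
(* The limsup of the heavy sets: a tail union misses at most mass [s ^+ k] for every large [k]. *)
pose B : set (measurableTypeR R) :=
  \bigcap_m \bigcup_(k in [set k | (m <= k)%N]) heavy (n k) (t k).
have mB : measurable B.
  apply: bigcapT_measurable => m; apply: bigcup_measurable => k _.
  exact: measurable_heavy.
have muB : mu y B = 1%E.
  rewrite -[B]setCK probability_setC; last exact: measurableC.
  rewrite (_ : mu y (~` B) = 0%E) ?sube0//.
  apply/(measure_negligible (measurableC mB)); rewrite /B setC_bigcap.
  apply: negligible_bigcup => m.
  exists (~` \bigcup_(k in [set k | (m <= k)%N]) heavy (n k) (t k)); split => //.
    apply: measurableC; apply: bigcup_measurable => k _; exact: measurable_heavy.
  apply/eqP; rewrite -measure_le0; apply/lee_addgt0Pr => e e0; rewrite add0e.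
  have [j hj] := expr_small (introT andP (conj (ltW s0) s1)) e0.
  pose k := maxn m j.
  apply: (@le_trans _ _ (mu y (~` heavy (n k) (t k)))).
    apply: le_measure; rewrite ?inE; [|exact: measurableC|].
      apply: measurableC; apply: bigcup_measurable => ? _; exact: measurable_heavy.
    by apply: subsetC => x xk; exists k => //=; exact: leq_maxl.
  apply: le_trans (mu_heavyC _ (t0 k)) _; rewrite lee_fin.
  by rewrite (le_trans (t_aff k))// ltW// hj// leq_maxr.
(* [r] solves [N ^ (r L) = 1 / s]. At most [N ^ n k * s ^+ (2 * k)] cylinders are heavy, and with
   [b = N ^ r] each contributes at most [N ^- n k * b * s ^- k] in exponent [1 - r], leaving
   [b * s ^+ k]. *)
pose r := - ln s / (L%:R * ln N%:R).
have LN0 : 0 < L%:R * ln (N%:R : R) by rewrite mulr_gt0// ltr0n.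
have lns : ln s < 0 by rewrite ln_lt0// s0.
have r0 : 0 < r by rewrite divr_gt0// oppr_gt0.
(* As [s >= 1 / 2], [- ln s <= ln 2 <= ln N]; so the exponent [1 - r] is nonnegative. *)
have r1 : r <= 1.
  rewrite ler_pdivrMr// mul1r -lnV ?posrE//.
  apply: (@le_trans _ _ (ln N%:R)); last by rewrite ler_pMl// ler1n.
  rewrite ler_ln ?posrE ?invr_gt0//; apply: (@le_trans _ _ 2); last by rewrite ler_nat.
  by rewrite -[leRHS]invrK lef_pV2 ?posrE ?invr_gt0.
pose b := expR (r * ln N%:R).
have bL : b ^+ L = s^-1.
  rewrite /b -expRM_natl /r -[RHS]lnK ?posrE ?invr_gt0// lnV ?posrE//; congr expR.
  by field; rewrite !gt_eqF// ltr0n.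
have powd k : (N%:R^-1 ^+ n k) `^ (1 - r) = N%:R^-1 ^+ n k * b ^+ n k.
  have d0 : 0 < N%:R^-1 ^+ n k :> R by rewrite exprn_gt0// invr_gt0.
  rewrite /powR gt_eqF// -[X in _ = X * _]lnK ?posrE// /b -expRM_natl -expRD; congr expR.
  by rewrite lnXn ?invr_gt0// lnV ?posrE// -mulr_natl; ring.
apply: (@le_lt_trans _ _ (1 - r)%:E); last by rewrite lte_fin gtrBl.
apply: (@le_trans _ _ (hausdorff_dim (B : set R))).
  by apply: ereal_inf_lbound; exists B.
apply: (@hausdorff_dim_limsup_le R _ (@cylinder R N) (fun k => heavy_words (n k) (t k))
  (fun k => N%:R^-1 ^+ n k) _ b s).
- by rewrite subr_ge0.
- exact: expR_ge0.
- by rewrite ltW.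
- by move=> k; rewrite exprn_ge0// invr_ge0.
- apply/cvgrPdist_lt => e /(expr_small (invN_itv N_gt1))[m hm].
  exists m => // k /= mk; rewrite sub0r normrN ger0_norm ?exprn_ge0 ?invr_ge0// hm//.
  by rewrite (leq_trans mk)// leqW// leq_pmulr.
- move=> k w; rewrite mem_filter mem_words => /andP[_ /eqP wn].
  apply: diameter_le; first by rewrite exprn_ge0// invr_ge0.
  by move=> x z wx wz; rewrite -wn; exact: cylinder_diff.
- move=> k; rewrite powd; set S := (size _)%:R.
  have St : S * N%:R^-1 ^+ n k <= s ^+ k * s ^+ k.
    have := size_heavy_words (n k) (t k); rewrite -/S /t exprMn.
    rewrite [c^-1 ^+ _ ^+ 2]exprAC [c^-1 ^+ 2]exprVn sqr_sqrtr// mulrA.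
    rewrite [s^-1 ^+ k]exprVn [(s ^+ k)^-1 ^+ 2]exprVn ler_pdivrMr ?exprn_gt0//.
    by rewrite mul1r expr2.
  have -> : b ^+ n k = b * s^-1 ^+ k by rewrite /n exprS mulnC exprM bL.
  rewrite mulrA; apply: le_trans (ler_wpM2r _ St) _.
    by rewrite mulr_ge0 ?expR_ge0// exprn_ge0// invr_ge0 ltW.
  rewrite exprVn le_eqVlt; apply/orP; left; apply/eqP; field.
  by rewrite gt_eqF// exprn_gt0.
- move=> x Bx m; have [k mk] := Bx m I.
  by move=> /heavyP[w wh wx]; exists k, w.
Qed.

(** The block ratio [M / c ^+ L] is below 1; [s] is its square root, raised to [1 / 2] if
    smaller. *)
Lemma measure_hausdorff_dim_lt1 (L : nat) (M : R) : (0 < L)%N -> M < c ^+ L ->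
  (forall k, affinity H G (k * L).+1 y <= c * M ^+ k) -> 0 <= M ->
  (measure_hausdorff_dim (mu y) < 1)%E.
Proof.
move=> L0 Mc aff M0; have cL0 : 0 < c ^+ L by rewrite exprn_gt0// sqrtN_gt0.
pose s := Num.max (2^-1) (Num.sqrt (M / c ^+ L)).
have s2 : 2^-1 <= s by rewrite le_max lexx.
apply: (measure_hausdorff_dim_lt1_sqr (s := s) L0).
  rewrite s2 /= gt_max invf_lt1// ltr1n /=.
  by rewrite -[ltRHS]sqrtr1 ltr_sqrt// ltr_pdivrMr// mul1r.
move=> k; apply: le_trans (aff k) _; rewrite ler_wpM2l ?sqrtr_ge0//.
rewrite lerXn2r ?nnegrE//; first by rewrite mulr_ge0 ?sqr_ge0// ltW.
rewrite mulrC -ler_pdivrMr//.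
have Mc0 : 0 <= M / c ^+ L by rewrite divr_ge0// ltW.
rewrite -[leLHS](sqr_sqrtr Mc0) lerXn2r ?nnegrE ?sqrtr_ge0//.
  by apply: le_trans s2; rewrite invr_ge0.
by rewrite le_max lexx orbT.
Qed.

End dimension.

(** * Consequences of separation along the orbit *)

Section separation.
Context {R : realType} {N : nat} (N_gt1 : (1 < N)%N) (H G : 'I_N -> R -> R).
Context (H_unit : forall i (z : R), 0 <= z <= 1 -> 0 <= H i z <= 1)
  (G_unit : forall i (z : R), 0 <= z <= 1 -> 0 <= G i z <= 1)
  (G_sum : forall z : R, 0 <= z <= 1 -> \sum_(i < N) G i z = 1).
Context (mu : R -> probability (measurableTypeR R) R)
  (mu_eq : self_similar_family H G mu).
Context (y : R) (hy : 0 <= y <= 1) (mu_no_atoms : forall x : R, mu y [set x] = 0%E).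

Let N_gt0 : (0 < N)%N. Proof. exact: ltnW. Qed.
Local Notation c := (Num.sqrt N%:R : R).

Lemma orbit_unit z : orbit_set H y z -> 0 <= z <= 1.
Proof. by move=> [w _ <-]; exact: compose_word_unit. Qed.

Lemma orbit_set_step i z : orbit_set H y z -> orbit_set H y (H i z).
Proof.
move=> [w _ <-]; exists (rcons w i); first by rewrite /= size_rcons.
by rewrite /compose_word foldl_rcons.
Qed.

Lemma orbit_set1 i : orbit_set H y (H i y).
Proof. by exists [:: i]. Qed.

Lemma word_weight_ge (a : R) w z : 0 <= a ->
  (forall i t, orbit_set H y t -> a <= G i t) -> orbit_set H y z ->
  a ^+ size w <= word_weight H G w z.
Proof.
move=> a0 aG; elim: w z => [|i w IHw] z oz /=; first by rewrite expr0.
by rewrite exprS ler_pM ?exprn_ge0 ?aG ?IHw//; exact: orbit_set_step.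
Qed.

Lemma Sep_far (e : R) w z : Sep H G y e w -> orbit_set H y z ->
  (exists i, ~ near_uniform N e (G i z)) \/
  (exists j, ~ near_uniform N e (G j (compose_word H w z))).
Proof.
move=> sep oz; apply: contrapT => /not_orP[/forallNP near1 /forallNP near2].
have : set0 z; last by [].
rewrite -sep; split; first split => //.
- by move=> i _; exact: (contrapT (near1 i)).
- by move=> j _; exact: (contrapT (near2 j)).
Qed.

Lemma nonzero_derivative_not_Sep (x e : R) : 0 <= x <= 1 -> 0 < e ->
  has_nonzero_derivative (distribution_function (mu y)) x ->
  exists m, forall u w, (m <= size u)%N -> cylinder (u ++ w) x -> ~ Sep H G y e w.
Proof.
move=> hx e0 /(weights_near_uniform N_gt1 H_unit G_unit mu_eq hy mu_no_atoms hx e0)[m near].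
(* One letter more than [m] makes [u] nonempty, as [orbit_set] requires. *)
exists m.+1 => u w mu_u ux /Sep_far far.
have /far : orbit_set H y (compose_word H u y) by exists u => //; exact: leq_trans mu_u.
case=> -[i]; first by apply; apply: near (ltnW mu_u) (cylinder_catl N_gt0 ux) i.
have -> : compose_word H w (compose_word H u y) = compose_word H (u ++ w) y.
  by rewrite /compose_word foldl_cat.
by apply; apply: near ux i; rewrite size_cat (leq_trans (ltnW mu_u))// leq_addr.
Qed.

(** A weight far from [1 / N] at [z] costs [k * c ^+ l]; one found after [w] costs at least [k]
    times the square root of [t]. The smaller cost is uniform in [z], although [w] may depend on
    [z]. *)
Lemma Sep_affinity_gap l (e t : R) : 0 < e -> 0 < t ->
  (forall z, orbit_set H y z -> exists w,
    [/\ size w = l, t <= word_weight H G w z & Sep H G y e w]) ->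
  exists2 M, M < c ^+ l.+1 &
    forall z, orbit_set H y z -> affinity H G l.+1 z <= M.
Proof.
move=> e0 t0 sep; have c0 : 0 < c by exact: sqrtN_gt0.
pose k : R := c * e ^+ 2 / 8.
have k0 : 0 < k by rewrite divr_gt0// mulr_gt0// exprn_gt0.
exists (c ^+ l.+1 - Num.min (k * c ^+ l) (k * Num.sqrt t)).
  by rewrite gtrBl lt_min !mulr_gt0 ?exprn_gt0 ?(sqrtr_gt0 t).
move=> z oz; have hz := orbit_unit oz.
have [w [wl wt /Sep_far/(_ oz)[[i far]|[j far]]]] := sep z oz.
  have := @affinityD_le _ _ H G G_unit [set s | 0 <= s <= 1] 1 l (c ^+ l) z
    (fun _ => id) H_unit (affinity_le H_unit G_unit G_sum N_gt0 l) hz.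
  rewrite add1n => /le_trans; apply.
  apply: le_trans (ler_wpM2r _ (affinity1_gap H G_unit G_sum N_gt0 hz e0 far)) _.
    by rewrite exprn_ge0// sqrtr_ge0.
  by rewrite -/k mulrBl -exprS lerD2l lerN2 ge_min lexx.
have gap := affinity1_gap H G_unit G_sum N_gt0 (compose_word_unit H_unit w hz) e0 far.
have := affinity_word_gap H_unit G_unit G_sum N_gt0 hz gap.
rewrite wl => /le_trans; apply.
by rewrite lerD2l lerN2 ge_min orbC ler_wpM2l ?ler_wsqrtr// ltW.
Qed.

Lemma Sep_dim_lt1 l (e t : R) : 0 < e -> 0 < t ->
  (forall z, orbit_set H y z -> exists w,
    [/\ size w = l, t <= word_weight H G w z & Sep H G y e w]) ->
  (measure_hausdorff_dim (mu y) < 1)%E.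
Proof.
move=> e0 t0 sep; have [M Mc leM] := Sep_affinity_gap e0 t0 sep.
have M0 : 0 <= M by apply: le_trans (leM _ (orbit_set1 (Ordinal N_gt0))); exact: affinity_ge0.
apply: (measure_hausdorff_dim_lt1 N_gt1 H_unit G_unit G_sum mu_eq hy mu_no_atoms _ Mc) => // k.
(* [y] need not lie in its own orbit set, so one level is peeled off and the blocks start at the
   points [H i y]. *)
rewrite (affinityS H G_unit)//.
apply: le_trans (ler_wpM2r (exprn_ge0 k M0) (affinity1_le H G_unit G_sum N_gt0 hy)).
rewrite affinityS// mulr_suml; apply: ler_sum => i _.
rewrite affinity0 mulr1 ler_wpM2l ?sqrtr_ge0//.
exact: (affinity_block G_unit k orbit_unit orbit_set_step leM M0 (orbit_set1 i)).
Qed.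

End separation.

(** * Deduction of the three assertions *)

Theorem theorem3p10 (R : realType) (N : nat) (hN : (2 <= N)%N)
    (H G : 'I_N -> R -> R)
    (H_unit : forall (i : 'I_N) (y : R), 0 <= y <= 1 -> 0 <= H i y <= 1)
    (G_unit : forall (i : 'I_N) (y : R), 0 <= y <= 1 -> 0 <= G i y <= 1)
    (G_sum : forall y : R, 0 <= y <= 1 -> \sum_(i < N) G i y = 1)
    (mu : R -> probability (measurableTypeR R) R)
    (mu_eq : self_similar_family H G mu)
    (y : R) (hy : 0 <= y <= 1)
    (mu_no_atoms : forall x : R, mu y [set x] = 0%E) :
  [/\ (* (i) *)
      [/\ 0 < inf (orbit_weights H G y),
          inf (orbit_weights H G y) <= sup (orbit_weights H G y)
        & sup (orbit_weights H G y) < 1] ->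
      (exists eps : R, exists l : nat, exists w : l.-tuple 'I_N,
        [/\ 0 < eps < N%:R^-1, (1 <= l)%N & Sep H G y eps w]) ->
      (measure_hausdorff_dim (mu y) < 1)%E,
      (* (ii) *)
      (exists eps : R, exists l : nat, exists w : l.-tuple 'I_N,
        [/\ 0 < eps < N%:R^-1, (1 <= l)%N & Sep H G y eps w]) ->
      forall (p : 'I_N -> R) (nu : probability (measurableTypeR R) R),
        (forall i, 0 < p i) -> \sum_(i < N) p i = 1 ->
        self_similar_measure p nu ->
        {ae nu, forall x : R, 0 <= x <= 1 ->
          ~ has_nonzero_derivative (distribution_function (mu y)) x}
    & (* (iii) *)
      (exists eps : R, exists l : nat,
        [/\ 0 < eps < N%:R^-1, (1 <= l)%N
          & forall w : l.-tuple 'I_N, Sep H G y eps w]) ->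
      (forall x : R, 0 <= x <= 1 ->
        ~ has_nonzero_derivative (distribution_function (mu y)) x) /\
      (measure_hausdorff_dim (mu y) < 1)%E].
Proof.
have N_gt0 : (0 < N)%N by exact: ltnW.
split.
- move=> [a0 _ _] [e [l [w [/andP[e0 _] _ sep]]]].
  have aG i t : orbit_set H y t -> inf (orbit_weights H G y) <= G i t.
    move=> ot; apply: ge_inf; last by exists (i, t).
    exists 0 => _ [[j s] [_ /= os] <-]; have hs := orbit_unit H_unit hy os.
    by case/andP: (G_unit j s hs).
  apply: (Sep_dim_lt1 (l := l) hN H_unit G_unit G_sum mu_eq hy mu_no_atoms e0
    (exprn_gt0 l a0)) => z oz.
  exists w; split => //; first exact: size_tuple.
  by have := word_weight_ge w (ltW a0) aG oz; rewrite size_tuple.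
- move=> [e [l [w [/andP[e0 _] _ sep]]]] p nu p0 p1 nu_eq.
  apply: negligibleS (self_similar_recurrence N_gt0 p0 p1 nu_eq w) => x.
  apply: contra_not => rec hx.
  move=> /(nonzero_derivative_not_Sep hN H_unit G_unit mu_eq hy mu_no_atoms hx e0)[m nsep].
  by have [u mu_u ux] := rec m; exact: nsep mu_u ux sep.
move=> [e [l [/andP[e0 _] _ sep]]]; split=> [x hx|].
  move=> /(nonzero_derivative_not_Sep hN H_unit G_unit mu_eq hy mu_no_atoms hx e0)[m nsep].
  (* The word is cut into a prefix of length [m] and a separating word of length [l]. *)
  have [w wn] := cylinder_exists N_gt0 (m + l)%N hx.
  rewrite -(cat_take_drop m w).
  have sw : size (drop m w) == l by rewrite size_drop wn addKn.
  move=> wx; apply: nsep wx (sep (Tuple sw)).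
  by rewrite size_take wn; case: ltnP => // _; exact: leq_addr.
apply: (Sep_dim_lt1 (l := l) hN H_unit G_unit G_sum mu_eq hy mu_no_atoms e0
  (exprn_gt0 l (_ : 0 < N%:R^-1))) => [|z oz]; first by rewrite invr_gt0 ltr0n.
(* A word of weight at least [N ^- l] is chosen at each orbit point; [Sep] holds for it as for every
   word of length [l]. *)
have [w wl wz] := word_weight_exists H_unit G_sum N_gt0 l (orbit_unit H_unit hy oz).
exists w; split => //.
have sw : size w == l by rewrite wl.
exact: (sep (Tuple sw)).
Qed.
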